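(* The finite difference problem $$\alpha u_i^{n+1}+\beta u_i^{n}+\gamma u_i^{n-1}+\delta u_{i+1}^{n}+\varepsilon u_{i-1}^{n}+\zeta u_{i+1}^{n+1}+\eta u_{i-1}^{n-1}+\theta u_{i-1}^{n+1}+\vartheta u_{i+1}^{n-1}=0$$ can be written in the matrix form $$M_1U+UM_2+\mathcal{L}(U)=M_0,$$ where $U=[u_i^n]_{1\le i\le n_x-1,\ 1\le n\le n_t}$, $M_1$ and $M_2$ are the square matrices, respectively $(n_x-1)\times(n_x-1)$ and $n_t\times n_t$, given in the context, $M_0$ is the matrix given in the context, and $\mathcal{L}=\mathcal{L}_1+\mathcal{L}_2+\mathcal{L}_3+\mathcal{L}_4$ is the linear matrix operator whose four parts are given in the context.
   Context: The scheme is a finite difference scheme for the transport equation $\partial_t u+\partial_x u=0$, $x\in[0,L]$, $t\in[0,T]$, with initial condition $u(x,0)=u_0(x)$. Here $u_l^m=u(lh,m\tau)$ for $l\in\{i-1,i,i+1\}$, $m\in\{n-1,n,n+1\}$; the space index is $i=0,\dots,n_x$ and the time index is $n=0,\dots,n_t$; $h$ and $\tau$ are the mesh size and the time step, with $L=n_xh$, $T=n_t\tau$. A particular scheme is specified by the choice of the coefficients $\alpha,\beta,\gamma,\delta,\varepsilon,\zeta,\eta,\theta,\vartheta$. Matrix entries of $U$, $M_0$ and $\mathcal{L}_k(U)$ are indexed by $1\le i\le n_x-1$ (row, space) and $1\le n\le n_t$ (column, time). $M_1$ is the $(n_x-1)\times(n_x-1)$ tridiagonal matrix with all diagonal entries $\beta$,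 all superdiagonal entries $\delta$, all subdiagonal entries $\varepsilon$. $M_2$ is the $n_t\times n_t$ tridiagonal matrix with all diagonal entries $0$, all superdiagonal entries $\gamma$, all subdiagonal entries $\alpha$. The operators are: - $\mathcal{L}_1(U)_{i,n}=\zeta u_{i+1}^{n+1}$ if $i\le n_x-2$ and $n\le n_t-1$, and $0$ otherwise; - $\mathcal{L}_2(U)_{i,n}=\eta u_{i-1}^{n-1}$ if $i\ge2$ and $n\ge2$, and $0$ otherwise; - $\mathcal{L}_3(U)_{i,n}=\theta u_{i-1}^{n+1}$ if $i\ge2$ and $n\le n_t-1$, and $0$ otherwise; - $\mathcal{L}_4(U)_{i,n}=\vartheta u_{i+1}^{n-1}$ if $i\le n_x-2$ and $n\ge2$, and $0$ otherwise. $M_0$ has the entries: - $(M_0)_{1,1}=-\gamma u_1^0-\varepsilon u_0^1-\eta u_0^0-\theta u_0^2-\vartheta u_2^0$; - $(M_0)_{1,n}=-\varepsilon u_0^n-\eta u_0^{n-1}-\theta u_0^{n+1}$ for $2\le n\le n_t-1$; - $(M_0)_{1,n_t}=-\varepsilon u_0^{n_t}-\eta u_0^{n_t-1}$; - $(M_0)_{i,1}=-\gamma u_i^0-\eta u_{i-1}^0-\vartheta u_{i+1}^0$ for $2\le i\le n_x-2$; - $(M_0)_{i,n}=0$ for $2\le i\le n_x-2$, $2\le n\le n_t$; - $(M_0)_{n_x-1,1}=-\gamma u_{n_x-1}^0-\delta u_{n_x}^1-\eta u_{n_x-2}^0-\zeta u_{n_x}^2-\vartheta u_{n_x}^0$;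 - $(M_0)_{n_x-1,n}=-\delta u_{n_x}^n-\zeta u_{n_x}^{n+1}-\vartheta u_{n_x}^{n-1}$ for $2\le n\le n_t-1$; - $(M_0)_{n_x-1,n_t}=-\delta u_{n_x}^{n_t}-\vartheta u_{n_x}^{n_t-1}$.
   Formalization: In the scheme at the last time level n = n_t, the terms at level n_t+1, which lie off the grid, are taken to be 0 (otherwise the claim fails); n_x ≥ 3 and n_t ≥ 2 are assumed so that the cases defining M_0 do not conflict. *)

(* Defs.v *)
From HB Require Import structures.
From mathcomp Require Import all_boot all_order all_algebra.

Set Implicit Arguments.
Unset Strict Implicit.
Unset Printing Implicit Defensive.

Import GRing.Theory.
Local Open Scope ring_scope.

(* Entry of A at row i and column j (counted from 0, as everywhere in the     *)
(* matrix library), for arbitrary natural numbers i and j: it is 0 as soon as *)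
(* (i, j) is not a position of A.                                             *)
Definition mxget (R : comNzRingType) (m p : nat) (A : 'M[R]_(m, p))
    (i j : nat) : R :=
  match insub i, insub j with
  | Some i', Some j' => A i' j'
  | _, _ => 0
  end.

Section Scheme.

Variables (R : comNzRingType) (nx nt : nat).
Variables (alpha beta gamma delta epsilon zeta eta theta vtheta : R).

(* A grid function assigns a value u_i^n to each node 0 <= i <= nx,           *)
(* 0 <= n <= nt; here u_i^n is mxget u i n.                                   *)
Definition grid_function := 'M[R]_(nx.+1, nt.+1).

(* The left-hand side of the scheme at the node (i, n).  For 1 <= i < nx and  *)
(* 1 <= n < nt all nine nodes lie on the grid.  At the last time level n = nt *)
(* there is no level nt + 1, and mxget gives the terms in alpha, zeta, theta  *)
(* the value 0: this is the truncation built into the last columns of M2, L1, *)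
(* L3 and M0.                                                                 *)
Definition stencil (u : grid_function) (i n : nat) : R :=
  alpha * mxget u i n.+1 + beta * mxget u i n + gamma * mxget u i n.-1
  + delta * mxget u i.+1 n + epsilon * mxget u i.-1 n
  + zeta * mxget u i.+1 n.+1 + eta * mxget u i.-1 n.-1
  + theta * mxget u i.-1 n.+1 + vtheta * mxget u i.+1 n.-1.

Definition fd_problem (u : grid_function) : Prop :=
  forall i n : nat, (1 <= i <= nx - 1)%N -> (1 <= n <= nt)%N ->
    stencil u i n = 0.

(* Below, the ordinals i : 'I_(nx - 1) and n : 'I_nt stand for the row i.+1   *)
(* and the column n.+1 in the usual numbering from 1.                         *)
Definition Umx (u : grid_function) : 'M[R]_(nx - 1, nt) :=
  \matrix_(i, n) mxget u i.+1 n.+1.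

Definition tridiag (k : nat) (diag super sub : R) : 'M[R]_k :=
  \matrix_(i, j) if (j : nat) == i then diag
                 else if (j : nat) == i.+1 then super
                 else if (i : nat) == j.+1 then sub
                 else 0.

Definition M1 : 'M[R]_(nx - 1) := tridiag (nx - 1) beta delta epsilon.

Definition M2 : 'M[R]_nt := tridiag nt 0 gamma alpha.

Definition L1 (V : 'M[R]_(nx - 1, nt)) : 'M[R]_(nx - 1, nt) :=
  \matrix_(i, n) if (i.+1 <= nx - 2)%N && (n.+1 <= nt - 1)%N
                 then zeta * mxget V i.+1 n.+1 else 0.

Definition L2 (V : 'M[R]_(nx - 1, nt)) : 'M[R]_(nx - 1, nt) :=
  \matrix_(i, n) if (2 <= i.+1)%N && (2 <= n.+1)%N
                 then eta * mxget V i.-1 n.-1 else 0.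

Definition L3 (V : 'M[R]_(nx - 1, nt)) : 'M[R]_(nx - 1, nt) :=
  \matrix_(i, n) if (2 <= i.+1)%N && (n.+1 <= nt - 1)%N
                 then theta * mxget V i.-1 n.+1 else 0.

Definition L4 (V : 'M[R]_(nx - 1, nt)) : 'M[R]_(nx - 1, nt) :=
  \matrix_(i, n) if (i.+1 <= nx - 2)%N && (2 <= n.+1)%N
                 then vtheta * mxget V i.+1 n.-1 else 0.

Definition Lop (V : 'M[R]_(nx - 1, nt)) : 'M[R]_(nx - 1, nt) :=
  L1 V + L2 V + L3 V + L4 V.

(* Here i and n are numbered from 1.  The case split needs a matrix with at   *)
(* least two rows and two columns, i.e. 3 <= nx and 2 <= nt.                 *)
Definition M0_entry (u : grid_function) (i n : nat) : R :=
  let v := mxget u in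
  if i == 1%N then
    if n == 1%N then
      - gamma * v 1%N 0%N - epsilon * v 0%N 1%N - eta * v 0%N 0%N
      - theta * v 0%N 2%N - vtheta * v 2%N 0%N
    else if (n <= nt - 1)%N then
      - epsilon * v 0%N n - eta * v 0%N (n - 1)%N - theta * v 0%N n.+1
    else
      - epsilon * v 0%N nt - eta * v 0%N (nt - 1)%N
  else if (i <= nx - 2)%N then
    if n == 1%N then
      - gamma * v i 0%N - eta * v (i - 1)%N 0%N - vtheta * v i.+1 0%N
    else 0
  else
    if n == 1%N then
      - gamma * v (nx - 1)%N 0%N - delta * v nx 1%N - eta * v (nx - 2)%N 0%N
      - zeta * v nx 2%N - vtheta * v nx 0%N
    else if (n <= nt - 1)%N then
      - delta * v nx n - zeta * v nx n.+1 - vtheta * v nx (n - 1)%N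
    else
      - delta * v nx nt - vtheta * v nx (nt - 1)%N.

Definition M0 (u : grid_function) : 'M[R]_(nx - 1, nt) :=
  \matrix_(i, n) M0_entry u i.+1 n.+1.

End Scheme.

(* Main.v *)
Require Import Defs.
From HB Require Import structures.
From mathcomp Require Import all_boot all_order all_algebra.
From mathcomp Require Import ring zify.

Set Implicit Arguments.
Unset Strict Implicit.
Unset Printing Implicit Defensive.

Import GRing.Theory.
Local Open Scope ring_scope.

(** The scheme and the matrix equation are the same system of equations, one
    for each interior row and each time level after the initial one: the entry
    of M1 U + U M2 + L(U) - M0 at such a position is exactly the stencil at the
    corresponding node ([matrix_form_entry]).

    Indeed a tridiagonal factor on the left combines spatial neighbours of an
    entry, one on the right combines its temporal neighbours
    ([tridiag_mulmxE], [mulmx_tridiagE]), and the four parts of L contribute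
    the diagonal neighbours.  What these products miss are the neighbours lying
    outside U.  Such a node either carries an initial or boundary value, and
    then -M0 supplies precisely the missing term, or belongs to the time level
    nt + 1, where the stencil itself reads the value 0.  Hence the identity
    only has to be compared in the nine positions (first, inner or last row,
    first, inner or last column), and in each of them both sides are the same
    combination of grid values. *)

Section Entries.

Variable R : comNzRingType.

Lemma mxgetE m p (A : 'M[R]_(m, p)) (i : 'I_m) (j : 'I_p) : mxget A i j = A i j.
Proof. by rewrite /mxget !valK. Qed.

Lemma mxget_out m p (A : 'M[R]_(m, p)) (i j : nat) :
  ~~ ((i < m) && (j < p))%N -> mxget A i j = 0.
Proof.
by rewrite /mxget negb_and; case: insubP => [? -> _|//] /=; case: insubP => [? ->|].
Qed.

Lemma mxget_trmx m p (A : 'M[R]_(m, p)) (i j : nat) :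
  mxget A^T i j = mxget A j i.
Proof.
by rewrite /mxget; case: insubP => [i' _ _|_]; case: insubP => // j' _ _; rewrite mxE.
Qed.

Lemma mxget_linear m p (a : R) (A B : 'M[R]_(m, p)) (i j : nat) :
  mxget (a *: A + B) i j = a * mxget A i j + mxget B i j.
Proof.
rewrite /mxget; case: insubP => [i' _ _|_]; last by rewrite mulr0 addr0.
by case: insubP => [j' _ _|_]; rewrite ?mxE // mulr0 addr0.
Qed.

Lemma mxget_Umx nx nt (u : grid_function R nx nt) (i n : nat) :
  mxget (Umx u) i n = if ((i < nx - 1) && (n < nt))%N
                      then mxget u i.+1 n.+1 else 0.
Proof.
case: ifPn => [/andP[hi hn]|/mxget_out //].
by rewrite -[i]/(val (Ordinal hi)) -[n]/(val (Ordinal hn)) mxgetE mxE.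
Qed.

(** An index past the last row selects nothing, in agreement with the default
    value of [mxget]; so the superdiagonal term of the last row of a
    tridiagonal product needs no separate treatment. *)
Lemma sum_select_row m p (V : 'M[R]_(m, p)) (c : R) (i : nat) (j : 'I_p) :
  \sum_(k < m) (if (k : nat) == i then c else 0) * V k j = c * mxget V i j.
Proof.
have [im|mi] := ltnP i m; last first.
  rewrite mxget_out ?ltnNge ?mi // mulr0 big1 // => k _.
  by rewrite ltn_eqF ?mul0r // (leq_trans (ltn_ord k)).
rewrite -[i]/(val (Ordinal im)) mxgetE (bigD1 (Ordinal im)) //= eqxx.
rewrite big1 ?addr0 // => k /negPf hk.
by rewrite -[i]/(val (Ordinal im)) (inj_eq val_inj) hk mul0r.
Qed.

(** The subdiagonal term needs an explicit test, unlike the superdiagonal one: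
    the predecessor of row 0 is row 0 itself, which lies inside the matrix. *)
Lemma tridiag_mulmxE m p (d s b : R) (V : 'M[R]_(m, p)) (i : 'I_m) (j : 'I_p) :
  (tridiag m d s b *m V) i j =
    d * mxget V i j + s * mxget V i.+1 j
    + (if (0 < i)%N then b * mxget V i.-1 j else 0).
Proof.
set low := (if _ then _ else _ : R).
have -> : low = \sum_(k < m)
    (if ((0 < i) && ((k : nat) == i.-1))%N then b else 0) * V k j.
  rewrite /low; case: (0 < i)%N; first by rewrite -sum_select_row.
  by rewrite big1 // => k _; rewrite mul0r.
rewrite -!sum_select_row -!big_split mxE /=; apply: eq_bigr => k _.
rewrite mxE -!mulrDl; congr (_ * _).
by do ![case: ifP => ?]; rewrite ?addr0 ?add0r //; exfalso; lia.
Qed.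

Lemma tridiag_trmx m (d s b : R) : (tridiag m d s b)^T = tridiag m d b s.
Proof.
apply/matrixP => i j; rewrite !mxE (eq_sym (i : nat)).
by do ![case: ifP => ?] => //; exfalso; lia.
Qed.

Lemma mulmx_tridiagE m p (d s b : R) (V : 'M[R]_(m, p)) (i : 'I_m) (j : 'I_p) :
  (V *m tridiag p d s b) i j =
    d * mxget V i j + b * mxget V i j.+1
    + (if (0 < j)%N then s * mxget V i j.-1 else 0).
Proof.
have -> : (V *m tridiag p d s b) i j = (tridiag p d b s *m V^T) j i.
  by rewrite -[V *m _]trmxK trmx_mul tridiag_trmx mxE.
by rewrite tridiag_mulmxE !mxget_trmx.
Qed.

Lemma Lop_linear nx nt (zeta eta theta vtheta : R) :
  linear (@Lop R nx nt zeta eta theta vtheta).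
Proof.
move=> a V W; apply/matrixP => i n; rewrite !mxE !mxget_linear.
by do ![case: ifP => _]; ring.
Qed.

(** The positions are split as in the definition of M0.  In an extreme row or
    column the guards of the products and of L drop exactly the neighbours
    outside U, which -M0 restores, apart from those at level nt + 1, which
    the stencil reads as 0. *)
Lemma matrix_form_entry nx nt
    (alpha beta gamma delta epsilon zeta eta theta vtheta : R)
    (hnx : (3 <= nx)%N) (hnt : (2 <= nt)%N) (u : grid_function R nx nt)
    (i : 'I_(nx - 1)) (n : 'I_nt) :
  (M1 nx beta delta epsilon *m Umx u + Umx u *m M2 nt alpha gamma
     + Lop zeta eta theta vtheta (Umx u)) i n
  - M0 gamma delta epsilon zeta eta theta vtheta u i n
  = stencil alpha beta gamma delta epsilon zeta eta theta vtheta u i.+1 n.+1.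
Proof.
rewrite mxE [X in X + _ - _]mxE tridiag_mulmxE mulmx_tridiagE !mxE.
rewrite !mxget_Umx /stencil /M0_entry.
have u_late a : mxget u a nt.+1 = 0 by rewrite mxget_out // ltnn andbF.
move: (mxget u) u_late => v v_late; case: i n => [i hi] [n hn] /=.
case: nx hnx {u} hi => [|[|[|p]]] // _; rewrite !subSS !subn0 => hi.
case: nt hnt hn v_late => [|[|q]] // _; rewrite !subSS !subn0 => hn v_late.
have row_cases : [\/ i = 0, 0 < i < p.+1 | i = p.+1]%N.
  have [->|] := eqVneq i 0%N; first by constructor 1.
  by have [->|] := eqVneq i p.+1; [constructor 3 | constructor 2; lia].
have col_cases : [\/ n = 0, 0 < n < q.+1 | n = q.+1]%N.
  have [->|] := eqVneq n 0%N; first by constructor 1.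
  by have [->|] := eqVneq n q.+1; [constructor 3 | constructor 2; lia].
(* In each position the remaining tests have a single consistent outcome. *)
case: row_cases => [? | /andP[i_gt0 i_lt] | ?];
  case: col_cases => [? | /andP[n_gt0 n_lt] | ?]; subst;
  do ?(case: ifP => ?; try (exfalso; lia)).
all: by rewrite ?v_late ?subn1 /= ?prednK //; ring.
Qed.

End Entries.

Theorem theorem3p1 (R : comNzRingType) (nx nt : nat)
    (alpha beta gamma delta epsilon zeta eta theta vtheta : R)
    (hnx : (3 <= nx)%N) (hnt : (2 <= nt)%N) :
  linear (@Lop R nx nt zeta eta theta vtheta) /\
  (forall u : grid_function R nx nt,
    fd_problem alpha beta gamma delta epsilon zeta eta theta vtheta u <->
    M1 nx beta delta epsilon *m Umx u + Umx u *m M2 nt alpha gamma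
      + Lop zeta eta theta vtheta (Umx u)
    = M0 gamma delta epsilon zeta eta theta vtheta u).
Proof.
split; first exact: Lop_linear.
move=> u; split=> [scheme|matrix_form i n].
  apply/matrixP => i n; apply/eqP; rewrite -subr_eq0 matrix_form_entry //.
  by rewrite scheme //; have := ltn_ord i; have := ltn_ord n; lia.
case: i n => [|i] [|n] //= hi hn; have {}hi : (i < nx - 1)%N by [].
rewrite -[i]/(val (Ordinal hi)) -[n]/(val (Ordinal hn)).
by rewrite -(matrix_form_entry _ _ _ _ _ _ _ _ _ hnx hnt) matrix_form subrr.
Qed.
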